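(* The category $\mathbf{ZLC}$ is dually equivalent to the category $\mathbf{DZLC}$, and the category $\mathbf{PZLC}$ is dually equivalent to the category $\mathbf{DPZLC}$.
   Context: Boolean algebras are allowed to be degenerate ($0=1$); the complement of $a$ is written $a^*$. $\mathbf{ZLC}$ is the category of zero-dimensional (i.e. having a base of clopen sets) locally compact Hausdorff spaces and continuous maps; $\mathbf{PZLC}$ is the category with the same objects and with perfect maps as morphisms (perfect = continuous, closed, with compact point-inverses; not necessarily onto). A contact relation on a Boolean algebra $A$ is a binary relation $\rho$ such that: $a\neq 0$ implies $a\rho a$; $a\rho b$ implies $a\ne 0$ and $b\neq 0$; $a\rho b$ implies $b\rho a$; $a\rho(b\vee c)$ iff ($a\rho b$ or $a\rho c$). Write $a\ll_\rho b$ iff not $a\,\rho\, b^*$. A local contact algebra (LCA) is a triple $(A,\rho,\mathbb{B})$ where $A$ is a Boolean algebra, $\rho$ is a contact relation on $A$ and $\mathbb{B}$ is an ideal of $A$ (possibly $\mathbb B=A$) such that (BC1) if $a\in\mathbb{B}$, $c\in A$ and $a\ll_\rho c$ then $a\ll_\rho b\ll_\rho c$ for some $b\in\mathbb{B}$; (BC2) if $a\rho b$ then there is $c\in\mathbb{B}$ with $a\rho(c\wedge b)$; (BC3) if $a\neq 0$ then there is $b\in\mathbb{B}\setminus\{0\}$ with $b\ll_\rho a$. A complete local contact algebra (CLCA) is an LCA $(A,\rho,\mathbb{B})$ with $A$ a complete Boolean algebra. $\mathbf{DLC}$ is the category whose objects are all CLCAs and whose morphisms $\varphi:(A,\rho,\mathbb{B})\to(B,\eta,\mathbb{B}')$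 are all functions $\varphi:A\to B$ such that (DLC1) $\varphi(0)=0$; (DLC2) $\varphi(a\wedge b)=\varphi(a)\wedge\varphi(b)$ for all $a,b\in A$; (DLC3) if $a\in\mathbb{B}$, $b\in A$ and $a\ll_\rho b$ then $(\varphi(a^* ))^*\ll_\eta\varphi(b)$; (DLC4) for every $b\in\mathbb{B}'$ there is $a\in\mathbb{B}$ with $b\le\varphi(a)$; (DLC5) $\varphi(a)=\bigvee\{\varphi(b)\mid b\in\mathbb{B},\ b\ll_\rho a\}$ for every $a\in A$. The composition of $\varphi_1:(A_1,\rho_1,\mathbb{B}_1)\to(A_2,\rho_2,\mathbb{B}_2)$ and $\varphi_2:(A_2,\rho_2,\mathbb{B}_2)\to(A_3,\rho_3,\mathbb{B}_3)$ is $(\varphi_2\diamond\varphi_1)(a)=\bigvee\{\varphi_2(\varphi_1(b))\mid b\in\mathbb{B}_1,\ b\ll_{\rho_1}a\}$; identities are identity functions. $\mathbf{PAL}$ is the subcategory of $\mathbf{DLC}$ with the same objects (all CLCAs) and with those $\mathbf{DLC}$-morphisms $\varphi:(A,\rho,\mathbb{B})\to(B,\eta,\mathbb{B}')$ that satisfy $\varphi(\mathbb{B})\subseteq\mathbb{B}'$. $\mathbf{DZLC}$ (resp. $\mathbf{DPZLC}$) is the full subcategory of $\mathbf{DLC}$ (resp. of $\mathbf{PAL}$) whose objects are all CLCAs $(A,\rho,\mathbb{B})$ such that whenever $a,b\in\mathbb{B}$ and $a\ll_\rho b$ there is $c\in\mathbb{B}$ with $c\ll_\rho c$ and $a\le c\le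 b$. Two categories are dually equivalent if one is equivalent to the opposite of the other. *)

(* Defs.v *)
From HB Require Import structures.
From mathcomp Require Import all_boot all_order.
From mathcomp Require Import boolp classical_sets filter topology.

Set Implicit Arguments.
Unset Strict Implicit.
Unset Printing Implicit Defensive.

Import Order.Theory.

Local Open Scope classical_set_scope.

(** * Categories *)

Record category := Category {
  obj :> Type;
  hom : obj -> obj -> Type;
  idm : forall x, hom x x;
  comp : forall x y z, hom y z -> hom x y -> hom x z;
  comp_idl : forall x y (f : hom x y), comp (idm y) f = f;
  comp_idr : forall x y (f : hom x y), comp f (idm x) = f;
  compA : forall x y z t (h : hom z t) (g : hom y z) (f : hom x y),
    comp h (comp g f) = comp (comp h g) f
}.

Arguments hom {c} x y.
Arguments idm {c} x.
Arguments comp {c x y z} g f.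

Definition opposite (C : category) : category :=
  @Category C (fun x y => hom y x) (fun x => idm x)
    (fun x y z g f => comp f g)
    (fun x y f => comp_idr f) (fun x y f => comp_idl f)
    (fun x y z t h g f => esym (compA f g h)).

Definition full_subcategory (C : category) (P : C -> Prop) : category :=
  @Category {x : C | P x} (fun x y => hom (sval x) (sval y))
    (fun x => idm (sval x)) (fun x y z g f => comp g f)
    (fun x y f => comp_idl f) (fun x y f => comp_idr f)
    (fun x y z t h g f => compA h g f).

Section WideSubcategory.
Variables (C : category) (P : forall x y : C, hom x y -> Prop).
Hypothesis P_id : forall x, P (idm x).
Hypothesis P_comp : forall x y z (g : hom y z) (f : hom x y),
  P g -> P f -> P (comp g f).

Let whom (x y : C) := {f : hom x y | P f}.

Lemma whom_inj (x y : C) (f g : whom x y) : sval f = sval g -> f = g.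
Proof.
case: f g => [f Pf] [g Pg] /= fg; rewrite -fg in Pg *.
by rewrite (Prop_irrelevance Pf Pg).
Qed.

Definition wide_subcategory : category.
Proof.
refine (@Category C whom (fun x => exist _ (idm x) (P_id x))
  (fun x y z g f => exist _ (comp (sval g) (sval f))
                            (P_comp (svalP g) (svalP f))) _ _ _).
- by move=> x y f; apply: whom_inj; apply: comp_idl.
- by move=> x y f; apply: whom_inj; apply: comp_idr.
- by move=> x y z t h g f; apply: whom_inj; apply: compA.
Defined.

End WideSubcategory.

Record functor (C D : category) := Functor {
  fobj :> C -> D;
  fmap : forall x y, hom x y -> hom (fobj x) (fobj y);
  fmap_id : forall x, fmap (idm x) = idm (fobj x);
  fmap_comp : forall x y z (g : hom y z) (f : hom x y),
    fmap (comp g f) = comp (fmap g) (fmap f)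
}.

Arguments fmap {C D} _ {x y} _.

Definition id_functor (C : category) : functor C C :=
  @Functor C C id (fun x y f => f) (fun x => erefl) (fun x y z g f => erefl).

Definition comp_functor (C D E : category) (G : functor D E) (F : functor C D) :
  functor C E.
Proof.
refine (@Functor C E (fun x => G (F x)) (fun x y f => fmap G (fmap F f)) _ _).
- by move=> x; rewrite !fmap_id.
- by move=> x y z g f; rewrite !fmap_comp.
Defined.

Definition is_isomorphism (C : category) (x y : C) (f : hom x y) : Prop :=
  exists g : hom y x, comp g f = idm x /\ comp f g = idm y.

Definition naturally_isomorphic (C D : category) (F G : functor C D) : Prop :=
  exists eta : forall x, hom (F x) (G x),
    (forall x y (f : hom x y), comp (eta y) (fmap F f) = comp (fmap G f) (eta x))
    /\ (forall x, is_isomorphism (eta x)).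

Definition equivalent (C D : category) : Prop :=
  exists (F : functor C D) (G : functor D C),
    naturally_isomorphic (id_functor C) (comp_functor G F) /\
    naturally_isomorphic (comp_functor F G) (id_functor D).

Definition dually_equivalent (C D : category) : Prop :=
  equivalent C (opposite D).

(** * Zero-dimensional locally compact Hausdorff spaces *)

Definition Top : category.
Proof.
refine (@Category topologicalType (fun X Y => continuousType X Y)
  (fun X => @idfun X) (fun X Y Z g f => g \o f) _ _ _).
- by move=> X Y f; apply/continuousEP.
- by move=> X Y f; apply/continuousEP.
- by move=> X Y Z T h g f; apply/continuousEP.
Defined.

(* The library's [zero_dimensional] only asks that points be separated by
   clopen sets. *)
Definition has_clopen_base (X : topologicalType) : Prop :=
  exists2 B : set (set X), basis B & B `<=` clopen.

Definition is_zlc (X : topologicalType) : Prop :=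
  [/\ hausdorff_space X, locally_compact [set: X] & has_clopen_base X].

Definition ZLC : category := full_subcategory (C := Top) is_zlc.

Definition perfect (X Y : topologicalType) (f : X -> Y) : Prop :=
  [/\ continuous f,
      forall C : set X, closed C -> closed (f @` C) &
      forall y : Y, compact (f @^-1` [set y])].

Lemma perfect_id (X : topologicalType) : perfect (@idfun X).
Proof.
split=> [x //|C|y]; first by rewrite image_id.
exact: compact_set1.
Qed.

Lemma perfect_compact_preimage (X Y : topologicalType) (f : X -> Y) (K : set Y) :
  perfect f -> compact K -> compact (f @^-1` K).
Proof.
move=> [_ f_closed f_fib] K_cpt F PF FK.
have [y [Ky cly]] := K_cpt (f @ F) _ FK.
apply: contrapT => F0.
have [A FA Ay] : exists2 A, F A & f @^-1` [set y] `<=` ~` closure A.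
  apply/near_powerset_filter_fromP => [A B AB By|].
    by apply: subset_trans By _; apply: subsetC; exact: closureS.
  apply: (proj1 (compact_near_coveringP _) (f_fib y) (set X)
    (powerset_filter_from F) (fun A x => ~ closure A x)) => x fx.
  have [A [U [FA Ux AU]]] :
      exists A U, [/\ F A, nbhs x U & A `&` U = set0].
    apply: contrapT => nAU; apply: F0; exists x; split.
      by rewrite /= fx.
    move=> A U FA Ux; apply/set0P/eqP => AU0; apply: nAU.
    by exists A, U.
  exists (U°, [set B | B `<=` A]) => /=; first split => //.
  - exact: nbhs_interior.
  - exact: small_set_sub.
  - move=> [x' B] /= [Ux' BA] /(_ _ Ux') [z [Bz Uz]].
    by have : (A `&` U) z by [split => //; exact: BA]; rewrite AU.
have fA_closed : closed (f @` closure A) by apply: f_closed; exact: closed_closure.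
have yfA : ~ (f @` closure A) y by move=> [x Ax fx]; exact: (Ay x fx).
have [z [fAz]] : f @` closure A `&` ~` (f @` closure A) !=set0.
  apply: cly.
  - apply: (@filterS _ F _ A) FA => x Ax; exists x => //; exact: subset_closure.
  - by apply: open_nbhs_nbhs; split => //; exact: closed_openC.
by apply.
Qed.

Lemma perfect_comp (X Y Z : topologicalType) (g : Y -> Z) (f : X -> Y) :
  perfect g -> perfect f -> perfect (g \o f).
Proof.
move=> [g_cts g_closed g_fib] f_perf; have [f_cts f_closed _] := f_perf.
split=> [|C C_closed|z].
- by move=> x; apply: continuous_comp; [exact: f_cts|exact: g_cts].
- by rewrite -image_comp; apply: g_closed; apply: f_closed.
- by rewrite comp_preimage; exact: perfect_compact_preimage.
Qed.

Definition PZLC : category :=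
  @wide_subcategory ZLC (fun X Y (f : @hom Top (sval X) (sval Y)) => perfect f)
    (fun X => perfect_id (sval X)) (fun X Y Z g f => @perfect_comp _ _ _ g f).

(** * Complete local contact algebras *)

Local Open Scope order_scope.

Section LocalContactAlgebra.
Variables (d : Order.disp_t) (A : ctbDistrLatticeType d).
Implicit Types (a b c : A) (rho : A -> A -> Prop) (BB S : set A).

Definition is_contact rho : Prop :=
  [/\ forall a, a != \bot -> rho a a,
      forall a b, rho a b -> a != \bot /\ b != \bot,
      forall a b, rho a b -> rho b a &
      forall a b c, rho a (b `|` c) <-> (rho a b \/ rho a c)].

Definition well_inside rho a b : Prop := ~ rho a (~` b).

Definition is_ideal BB : Prop :=
  [/\ BB \bot,
      forall a b, BB b -> a <= b -> BB a &
      forall a b, BB a -> BB b -> BB (a `|` b)].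

Definition is_lca rho BB : Prop :=
  [/\ is_contact rho /\ is_ideal BB,
      forall a c, BB a -> well_inside rho a c ->
        exists b, [/\ BB b, well_inside rho a b & well_inside rho b c],
      forall a b, rho a b -> exists2 c, BB c & rho a (c `&` b) &
      forall a, a != \bot ->
        exists b, [/\ BB b, b != \bot & well_inside rho b a]].

(* Joins suffice: all meets then exist, by complementation. *)
Definition is_complete : Prop := forall S, exists s, supremums S s.

(* [supremum \bot] is the least upper bound when there is one, also for the
   empty set. *)
Definition bigjoin S : A := supremum \bot S.

End LocalContactAlgebra.

Record clca := CLCA {
  clca_disp : Order.disp_t;
  clca_ba :> ctbDistrLatticeType clca_disp;
  contact : clca_ba -> clca_ba -> Prop;
  bounded : set clca_ba;
  clcaP : is_lca contact bounded;
  clca_complete : is_complete clca_ba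
}.

Arguments contact : clear implicits.
Arguments bounded : clear implicits.

Notation "a '<<[' A ']' b" := (@well_inside _ (clca_ba A) (contact A) a b)
  (at level 70, b at next level).

Definition inner (A : clca) (a : A) : set A :=
  [set b | bounded A b /\ b <<[A] a].

Definition is_dlc_morphism (A B : clca) (phi : A -> B) : Prop :=
  [/\ phi \bot = \bot,
      forall a b, phi (a `&` b) = phi a `&` phi b,
      forall a b, bounded A a -> a <<[A] b -> ~` phi (~` a) <<[B] phi b,
      forall b, bounded B b -> exists2 a, bounded A a & b <= phi a &
      forall a, phi a = bigjoin [set phi b | b in inner a]].

Definition dlc_hom (A B : clca) := {phi : A -> B | is_dlc_morphism phi}.

Lemma dlc_hom_inj (A B : clca) (phi psi : dlc_hom A B) :
  sval phi =1 sval psi -> phi = psi.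
Proof.
case: phi psi => [f Pf] [g Pg] /= /funext fg; rewrite -fg in Pg *.
by rewrite (Prop_irrelevance Pf Pg).
Qed.

Definition diamond (A B C : clca) (psi : B -> C) (phi : A -> B) (a : A) : C :=
  bigjoin [set psi (phi b) | b in inner a].

Section CLCATheory.
Variable A : clca.
Implicit Types (a b c : A) (S : set A).

Lemma bigjoinP S : supremums S (bigjoin S).
Proof.
rewrite /bigjoin /supremum; case: ifPn => [/eqP ->|_].
  by split=> [x //|x _]; exact: le0x.
by have [s Ss] := clca_complete S; case: xgetP => [y -> //|/(_ s)].
Qed.

Lemma bigjoin_ub S a : S a -> a <= bigjoin S.
Proof. by move=> Sa; apply: (proj1 (bigjoinP S)). Qed.

Lemma bigjoin_lub S a : (forall b, S b -> b <= a) -> bigjoin S <= a.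
Proof. by move=> Sa; apply: (proj2 (bigjoinP S)). Qed.

Lemma meet_bigjoin_le S a c :
  (forall b, S b -> a `&` b <= c) -> a `&` bigjoin S <= c.
Proof.
move=> Sac.
have : bigjoin S <= ~` a `|` c.
  apply: bigjoin_lub => b /Sac abc.
  rewrite -[b]meet1x -(joinCx a) meetUl leU2 //; exact: leIl.
move=> h; apply: le_trans (leI2 (lexx a) h) _.
by rewrite meetUr meetxC join0x leIr.
Qed.

Let contactA : is_contact (contact A).
Proof. by case: (clcaP A) => -[]. Qed.

Let idealA : is_ideal (bounded A).
Proof. by case: (clcaP A) => -[]. Qed.

Lemma contactC a b : contact A a b -> contact A b a.
Proof. by case: contactA => _ _ + _; exact. Qed.

Lemma contact_ler a b c : b <= c -> contact A a b -> contact A a c.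
Proof.
move=> bc ab; case: contactA => _ _ _ U.
by rewrite -(join_idPr bc); apply/U; left.
Qed.

Lemma contact_lel a b c : b <= c -> contact A b a -> contact A c a.
Proof. by move=> bc /contactC ba; apply/contactC/(contact_ler bc). Qed.

Lemma bounded0 : bounded A \bot. Proof. by case: idealA. Qed.

Lemma bounded_le a b : bounded A b -> a <= b -> bounded A a.
Proof. by case: idealA => _ + _; exact. Qed.

Lemma boundedU a b : bounded A a -> bounded A b -> bounded A (a `|` b).
Proof. by case: idealA => _ _; exact. Qed.

Lemma well_inside_le a b : a <<[A] b -> a <= b.
Proof.
case: contactA => refl _ _ _ ab.
suff : a `&` ~` b == \bot by rewrite disj_leC complK.
apply/negPn/negP => /refl h; apply: ab.
exact: contact_lel (leIl _ _) (contact_ler (leIr _ _) h).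
Qed.

Lemma well_insideW a a' b b' : a' <= a -> b <= b' -> a <<[A] b -> a' <<[A] b'.
Proof.
move=> aa bb ab h; apply: ab; apply: contact_lel aa _.
by apply: contact_ler h; rewrite leC.
Qed.

Lemma well_insideI a b c : a <<[A] b -> a <<[A] c -> a <<[A] (b `&` c).
Proof.
case: contactA => _ _ _ U ab ac; rewrite /well_inside complI.
by move=> /U[].
Qed.

Lemma well_inside1 a : a <<[A] \top.
Proof.
by case: contactA => _ + _ _ => n0 /n0[_]; rewrite compl1 eqxx.
Qed.

Lemma inner_interp a b : inner a b -> exists2 c, inner a c & inner c b.
Proof.
move=> [Bb ba]; case: (clcaP A) => _ /(_ _ _ Bb ba) + _ _.
by move=> [c [Bc bc ca]]; exists c.
Qed.

Lemma bounded_dense a c :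
  (forall b, inner a b -> b <= c) -> a <= c.
Proof.
move=> ac; suff : a `&` ~` c == \bot by rewrite disj_leC complK.
apply/negPn/negP => n0; case: (clcaP A) => _ _ _ /(_ _ n0) [b [Bb b0 bac]].
have bc : b <= c.
  by apply: ac; split=> //; apply: well_insideW bac => //; exact: leIl.
have bc' : b <= ~` c by apply: le_trans (well_inside_le bac) (leIr _ _).
by move/negP: b0; apply; rewrite -lex0 -(meetxC c) lexI bc.
Qed.

End CLCATheory.

Lemma dlc_id (A : clca) : is_dlc_morphism (@id A).
Proof.
split=> //.
- by move=> a b _ ab; rewrite complK.
- by move=> b Bb; exists b.
- move=> a; apply: le_anti; rewrite image_id; apply/andP; split.
    by apply: bounded_dense => b; exact: bigjoin_ub.
  by apply: bigjoin_lub => b [_]; exact: well_inside_le.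
Qed.

(* The set-theoretic composite of two morphisms of CLCAs satisfies every clause
   of [is_dlc_morphism] but the last, which [hat] restores; this is what makes
   [diamond] a morphism and an associative operation. *)
Section Premorphism.
Variables (A B : clca) (phi : A -> B).
Hypothesis phi0 : phi \bot = \bot.
Hypothesis phiI : forall a b, phi (a `&` b) = phi a `&` phi b.
Hypothesis phi_cof : forall b, bounded B b -> exists2 a, bounded A a & b <= phi a.

Lemma premorph_le a b : a <= b -> phi a <= phi b.
Proof. by move=> /meet_idPl ab; rewrite -ab phiI leIr. Qed.

Lemma premorph_leC a : phi a <= ~` phi (~` a).
Proof. by rewrite -disj_leC -phiI meetxC phi0. Qed.

Lemma premorph_dense a c :
  (forall b, bounded A b -> b <= a -> phi b <= c) -> phi a <= c.
Proof.
move=> ac; apply: bounded_dense => b [Bb /well_inside_le ba].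
have [g Bg bg] := phi_cof Bb.
apply: le_trans (ac (g `&` a) _ (leIr _ _)).
  by rewrite phiI lexI bg.
by apply: bounded_le Bg (leIl _ _).
Qed.

Definition hat (a : A) : B := bigjoin [set phi b | b in inner a].

Lemma hat_le a : hat a <= phi a.
Proof.
by apply: bigjoin_lub => _ [b [_ /well_inside_le ba] <-]; exact: premorph_le.
Qed.

Lemma le_hat a b : inner a b -> phi b <= hat a.
Proof. by move=> ab; apply: bigjoin_ub; exists b. Qed.

Lemma le_hat_well_inside a b : b <<[A] a -> phi b <= hat a.
Proof.
move=> ba; apply: premorph_dense => c Bc cb; apply: le_hat; split=> //.
exact: well_insideW cb (lexx _) ba.
Qed.

Lemma hat0 : hat \bot = \bot.
Proof. by apply/eqP; rewrite -lex0 -phi0; exact: hat_le. Qed.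

Lemma hatI a b : hat (a `&` b) = hat a `&` hat b.
Proof.
apply: le_anti; apply/andP; split.
  rewrite lexI; apply/andP; split; apply: bigjoin_lub => _ [c [Bc cab] <-];
    apply: le_hat; split=> //; apply: well_insideW cab => //.
  - exact: leIl.
  - exact: leIr.
apply: meet_bigjoin_le => _ [c [Bc cb] <-]; rewrite meetC.
apply: meet_bigjoin_le => _ [e [Be ea] <-]; rewrite meetC -phiI.
apply: le_hat; split; first exact: bounded_le Be (leIl _ _).
apply: well_insideI; first exact: well_insideW (leIl _ _) (lexx _) ea.
exact: well_insideW (leIr _ _) (lexx _) cb.
Qed.

Lemma hat_cof b : bounded B b -> exists2 a, bounded A a & b <= hat a.
Proof.
move=> /phi_cof[a Ba ba].
have [c [Bc _] [_ ac]] := inner_interp (conj Ba (@well_inside1 A a)).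
by exists c => //; apply: le_trans ba (le_hat _).
Qed.

Lemma hat_hat a : hat a = bigjoin [set hat b | b in inner a].
Proof.
apply: le_anti; apply/andP; split; apply: bigjoin_lub => _ [b ab <-].
  have [c ac bc] := inner_interp ab.
  by apply: le_trans (le_hat bc) _; apply: bigjoin_ub; exists c.
by apply: le_trans (hat_le b) (le_hat ab).
Qed.

Lemma hat_well_inside :
  (forall a b, a <<[A] b -> ~` phi (~` a) <<[B] phi b) ->
  forall a b, bounded A a -> a <<[A] b -> ~` hat (~` a) <<[B] hat b.
Proof.
move=> phi_wi a b Ba ab.
have [c [Bc cb] [_ ac]] := inner_interp (conj Ba ab).
have [e [Be eb] [_ ce]] := inner_interp (conj Bc cb).
apply: well_insideW (phi_wi _ _ ce); last exact: le_hat.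
rewrite leC; apply: le_hat_well_inside; rewrite /well_inside complK => h.
by apply: ac; exact: contactC.
Qed.

Lemma premorph_well_inside :
  (forall a b, bounded A a -> a <<[A] b -> ~` phi (~` a) <<[B] phi b) ->
  forall a b, a <<[A] b -> ~` phi (~` a) <<[B] phi b.
Proof.
move=> phi_wi a b ab; rewrite /well_inside => /contactC h.
case: (clcaP B) => _ _ /(_ _ _ h) [e Be] /contactC {}h _.
have [g Bg eg] := phi_cof Be.
apply: (phi_wi (a `&` g) b).
- exact: bounded_le Bg (leIr _ _).
- exact: well_insideW (leIl _ _) (lexx _) ab.
apply: contact_lel h; rewrite -disj_leC -lex0.
have : e `&` phi (~` (a `&` g)) <= phi (~` a).
  apply: le_trans (leI2 eg (lexx _)) _; rewrite -phiI; apply: premorph_le.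
  by rewrite complI meetUr meetxC joinx0 leIr.
move=> le; rewrite -(meetCx (phi (~` a))) lexI; apply/andP; split.
  by apply: le_trans (leIl _ _) _; exact: leIr.
by apply: le_trans le; apply: leI2 => //; exact: leIl.
Qed.

End Premorphism.

Lemma dlc_comp (A B C : clca) (psi : B -> C) (phi : A -> B) :
  is_dlc_morphism psi -> is_dlc_morphism phi -> is_dlc_morphism (diamond psi phi).
Proof.
move=> [psi0 psiI psi_wi psi_cof _] [phi0 phiI phi_wi phi_cof _].
pose chi := psi \o phi.
have chi0 : chi \bot = \bot by rewrite /chi /= phi0 psi0.
have chiI a b : chi (a `&` b) = chi a `&` chi b by rewrite /chi /= phiI psiI.
have chi_cof c : bounded C c -> exists2 a, bounded A a & c <= chi a.
  move=> /psi_cof[b /phi_cof[a Ba ba] cb]; exists a => //.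
  by apply: le_trans cb _; exact: (premorph_le psiI).
have chi_wi a b : a <<[A] b -> ~` chi (~` a) <<[C] chi b.
  move=> /(premorph_well_inside phiI phi_cof phi_wi).
  by move=> /(premorph_well_inside psiI psi_cof psi_wi); rewrite complK.
split.
- exact: hat0 chi0 chiI.
- exact: hatI chiI.
- exact: hat_well_inside chiI chi_cof chi_wi.
- exact: hat_cof chi_cof.
- exact: hat_hat chiI.
Qed.

Definition DLC : category.
Proof.
refine (@Category clca dlc_hom (fun A => exist _ id (dlc_id A))
  (fun A B C psi phi =>
     exist _ (diamond (sval psi) (sval phi)) (dlc_comp (svalP psi) (svalP phi)))
  _ _ _).
- by move=> A B [phi [? ? ? ? phi5]]; apply: dlc_hom_inj => a /=; rewrite [RHS]phi5.
- by move=> A B [phi [? ? ? ? phi5]]; apply: dlc_hom_inj => a /=; rewrite [RHS]phi5.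
move=> A B C D [chi chiP] [psi psiP] [phi phiP]; apply: dlc_hom_inj => a /=.
have [chi0 chiI _ chi_cof _] := chiP.
have [psi0 psiI _ psi_cof _] := psiP.
have [phi0 phiI phi_wi phi_cof _] := phiP.
have xpI b c : chi (psi (b `&` c)) = chi (psi b) `&` chi (psi c).
  by rewrite psiI chiI.
have ppI b c : psi (phi (b `&` c)) = psi (phi b) `&` psi (phi c).
  by rewrite phiI psiI.
have xp_cof c : bounded D c -> exists2 b, bounded B b & c <= chi (psi b).
  move=> /chi_cof[b /psi_cof[e Be be] cb]; exists e => //.
  by apply: le_trans cb _; exact: (premorph_le chiI).
apply: le_anti; apply/andP; split; apply: bigjoin_lub => _ [b ab <-].
- have [c ac [Bb bc]] := inner_interp ab.
  apply: (@le_trans _ _ (chi (psi (phi b)))).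
    by apply: (premorph_le chiI); exact: (hat_le ppI).
  apply: (@le_trans _ _ (diamond chi psi (phi c))).
    apply: (le_hat_well_inside xpI xp_cof).
    apply: well_insideW (phi_wi _ _ Bb bc) => //; exact: premorph_leC.
  by apply: bigjoin_ub; exists c.
- have [c ac bc] := inner_interp ab.
  apply: (@le_trans _ _ (chi (psi (phi b)))); first exact: (hat_le xpI).
  apply: (@le_trans _ _ (chi (diamond psi phi c))).
    by apply: (premorph_le chiI); apply: bigjoin_ub; exists b.
  by apply: bigjoin_ub; exists c.
Defined.

Definition preserves_bounded (A B : clca) (phi : dlc_hom A B) : Prop :=
  forall a, bounded A a -> bounded B (sval phi a).

Lemma preserves_bounded_id (A : DLC) : preserves_bounded (idm A).
Proof. by []. Qed.

Lemma preserves_bounded_comp (A B C : DLC) (psi : hom B C) (phi : hom A B) :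
  preserves_bounded psi -> preserves_bounded phi ->
  preserves_bounded (comp psi phi).
Proof.
move: psi phi => [psi psiP] [phi phiP] psiB phiB a Ba /=.
have [_ psiI _ _ _] := psiP; have [_ phiI _ _ _] := phiP.
apply: bounded_le (psiB _ (phiB _ Ba)) _.
by apply: (@hat_le _ _ (psi \o phi)) => b c /=; rewrite phiI psiI.
Qed.

Definition PAL : category :=
  wide_subcategory preserves_bounded_id preserves_bounded_comp.

Definition is_dzlc (A : clca) : Prop :=
  forall a b, bounded A a -> bounded A b -> a <<[A] b ->
    exists c, [/\ bounded A c, c <<[A] c & a <= c <= b].

Definition DZLC : category := full_subcategory (C := DLC) is_dzlc.

Definition DPZLC : category := full_subcategory (C := PAL) is_dzlc.

(* Main.v *)
(** The duality sends a space to the complete Boolean algebra of its regular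
    open sets, with [U << V] iff the closure of [U] lies in [V] and [U] bounded
    iff its closure is compact, and a map [f] to [U |-> int cl f^-1(U)]; this
    is the paper's algebra of regular closed sets, read through interiors.  In
    a DZLC-object every [a << b] with [a] bounded is interpolated by a bounded
    clopen [c], i.e. one with [c << c], so that morphisms out of it are
    determined by these elements; on spaces they are the compact clopen sets,
    on which the dual of [f] is the plain preimage.  A morphism thus gives each
    point [x] of the source space the ultrafilter of compact clopen [K] with
    [x] in [phi K], which converges: the functor is full and faithful, and it
    is essentially surjective by the Stone space of the generalized Boolean
    algebra of bounded clopen elements.  Perfect maps are exactly the maps
    whose dual preserves boundedness. *)

From HB Require Import structures.
From mathcomp Require Import all_boot all_order.
From mathcomp Require Import boolp classical_sets filter topology.
Require Import Defs.

Set Implicit Arguments.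
Unset Strict Implicit.
Unset Printing Implicit Defensive.

Import Order.Theory.

Local Open Scope classical_set_scope.

(** * Regular open sets *)

Section Regularization.
Variable X : topologicalType.
Implicit Types S T U : set X.

Definition reg S := (closure S)°.

Lemma open_reg S : open (reg S).
Proof. exact: open_interior. Qed.

Lemma regopen_reg S : regopen (reg S).
Proof. exact/interior_closed_regopen/closed_closure. Qed.

Lemma regopen_open U : regopen U -> open U.
Proof. by move=> <-; exact: open_interior. Qed.

Lemma subset_reg U : open U -> U `<=` reg U.
Proof. by move=> oU; rewrite /reg -open_subsetE//; exact: subset_closure. Qed.

Lemma regS S T : S `<=` T -> reg S `<=` reg T.
Proof. by move=> ST; apply/interiorS/closureS. Qed.

Lemma clopen_regopen U : clopen U -> regopen U.
Proof. by case=> /interior_id oU /closure_id cU; rewrite /regopen -cU. Qed.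

Lemma setI_closure_subset U S :
  open U -> U `&` closure S `<=` closure (U `&` S).
Proof.
move=> oU x [Ux Sx] N Nx; rewrite [_ `&` S]setIC -setIA.
by apply: Sx; apply: filterI => //; exact: open_nbhs_nbhs.
Qed.

(** The intersection of [reg U] and [reg T] is open, so it only has to lie in the closure of the
    intersection of [U] and [T]; [setI_closure_subset] achieves this one factor at a time. Hence
    meets of regular opens are plain intersections, and regularized preimages preserve them. *)
Lemma regI U T : open U -> open T -> reg (U `&` T) = reg U `&` reg T.
Proof.
move=> oU oT; apply/seteqP; split.
  by rewrite subsetI; split; apply: regS; [exact: subIsetl|exact: subIsetr].
have oUT : open (reg U `&` reg T) by apply: openI; exact: open_reg.
rewrite {2}/reg -open_subsetE// => x [Ux /interior_subset Tx].
have : closure (reg U `&` T) x.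
  by apply: setI_closure_subset => //; exact: open_reg.
move=> /(@closureS _ _ (closure (U `&` T))).
rewrite -(proj1 (closure_id _) (@closed_closure _ _)); apply.
move=> y [/interior_subset Uy Ty]; rewrite setIC.
exact: setI_closure_subset.
Qed.

End Regularization.

Record regopens (X : topologicalType) := Regopens {
  regset :> set X;
  regopen_regset : regopen regset
}.

Lemma regset_inj (X : topologicalType) : injective (@regset X).
Proof.
case=> U rU [V rV] /= UV; rewrite -UV in rV *.
by rewrite (Prop_irrelevance rU rV).
Qed.

HB.instance Definition _ X := gen_eqMixin (regopens X).
HB.instance Definition _ X := gen_choiceMixin (regopens X).

(** * The complete Boolean algebra of regular open sets *)

Section RegularOpenAlgebra.
Variable X : topologicalType.
Implicit Types U V W : regopens X.

Lemma open_regset U : open (regset U).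
Proof. exact/regopen_open/regopen_regset. Qed.

Let le U V := `[< U `<=` V >].

Let le_refl : reflexive le.
Proof. by move=> U; apply/asboolP. Qed.

Let le_anti : antisymmetric le.
Proof.
by move=> U V /andP[/asboolP ? /asboolP ?]; apply/regset_inj/seteqP.
Qed.

Let le_trans : transitive le.
Proof.
by move=> V U W /asboolP UV /asboolP VW; apply/asboolP/(subset_trans UV).
Qed.

HB.instance Definition _ := Order.Le_isPOrder.Build (Order.Disp tt tt)
  (regopens X) le_refl le_anti le_trans.

Lemma regopens_leP U V : reflect (U `<=` V) (U <= V)%O.
Proof. exact: asboolP. Qed.

Definition regopens_of (S : set X) := Regopens (regopen_reg S).

Fact regopen_setI U V : regopen (U `&` V).
Proof.
have := regI (open_regset U) (open_regset V).
by rewrite /reg !regopen_regset.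
Qed.

Let meet U V := Regopens (regopen_setI U V).
Let join U V := regopens_of (U `|` V).

Let meetP U V W : (U <= meet V W)%O = (U <= V)%O && (U <= W)%O.
Proof.
apply/regopens_leP/andP => [|[/regopens_leP UV /regopens_leP UW]].
  by rewrite subsetI => -[? ?]; split; apply/regopens_leP.
by rewrite subsetI.
Qed.

(** Regularization is left adjoint to the inclusion of regular opens into opens; binary joins and
    arbitrary suprema are both obtained from this. *)
Lemma regopens_of_le (S : set X) U :
  open S -> (regopens_of S <= U)%O <-> S `<=` U.
Proof.
move=> oS; split=> [/regopens_leP SU|SU].
  exact: subset_trans (subset_reg oS) SU.
by apply/regopens_leP; rewrite -(regopen_regset U); exact: regS.
Qed.

Let joinP U V W : (join U V <= W)%O = (U <= W)%O && (V <= W)%O.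
Proof.
apply/idP/andP => [/regopens_of_le|[/regopens_leP UV /regopens_leP UW]].
  rewrite subUset => /(_ (openU (open_regset U) (open_regset V)))[? ?].
  by split; apply/regopens_leP.
by apply/regopens_of_le; [apply: openU; exact: open_regset|rewrite subUset].
Qed.

HB.instance Definition _ := Order.POrder_MeetJoin_isLattice.Build
  (Order.Disp tt tt) (regopens X) meetP joinP.

Lemma regset_meet U V : regset (U `&` V)%O = regset U `&` regset V.
Proof. by []. Qed.

Lemma regset_join U V : regset (U `|` V)%O = reg (regset U `|` regset V).
Proof. by []. Qed.

Let meetUl : @left_distributive (regopens X) (regopens X) Order.meet Order.join.
Proof.
move=> U V W; apply: regset_inj.
(* Since [W] is its own regularization, set-theoretic distributivity passes through [regI]. *)
rewrite !(regset_meet, regset_join) -setIUl regI; last exact: open_regset.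
  by rewrite {3}/reg regopen_regset.
by apply: openU; exact: open_regset.
Qed.

HB.instance Definition _ := Order.Lattice_Meet_isDistrLattice.Build
  (Order.Disp tt tt) (regopens X) meetUl.

Let bot := Regopens (clopen_regopen (@clopen0 X)).
Let top := Regopens (clopen_regopen (@clopenT X)).

Let le0 U : (bot <= U)%O.
Proof. exact/regopens_leP. Qed.

Let le1 U : (U <= top)%O.
Proof. exact/regopens_leP. Qed.

HB.instance Definition _ := Order.hasBottom.Build
  (Order.Disp tt tt) (regopens X) le0.
HB.instance Definition _ := Order.hasTop.Build
  (Order.Disp tt tt) (regopens X) le1.

Lemma regset0 : regset (\bot : regopens X)%O = set0.
Proof. by []. Qed.

Lemma regset1 : regset (\top : regopens X)%O = setT.
Proof. by []. Qed.

Fact regopen_setC_closure U : regopen (~` closure U).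
Proof.
rewrite -interiorC; apply: interior_closed_regopen.
exact/open_closedC/open_regset.
Qed.

Let compl U := Regopens (regopen_setC_closure U).

Let joinxC U : (U `|` compl U)%O = \top%O.
Proof.
apply: regset_inj; rewrite regset_join regset1 /reg -[RHS]interiorT.
congr _°; apply/seteqP; split=> // x _; rewrite closureU.
have [?|Ux] := pselect (closure U x); [by left|right].
exact: subset_closure.
Qed.

Let meetxC U : (U `&` compl U)%O = \bot%O.
Proof.
apply: regset_inj; rewrite regset_meet regset0 -subset0 => x [/subset_closure].
by move=> ? [].
Qed.

HB.instance Definition _ := Order.TBDistrLattice_hasComplement.Build
  (Order.Disp tt tt) (regopens X) joinxC meetxC.

Lemma regset_compl U : regset (~` U)%O = ~` closure (regset U).
Proof. by []. Qed.

Lemma regopens_complete : is_complete (regopens X).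
Proof.
move=> S; pose W := \bigcup_(U in S) regset U.
have oW : open W by apply: bigcup_open => U _; exact: open_regset.
exists (regopens_of W); split=> U SU.
  apply/regopens_leP/(subset_trans _ (subset_reg oW)).
  by move=> x Ux; exists U.
by apply/regopens_of_le => // x [V SV Vx]; exact/(regopens_leP _ _ (SU _ SV)).
Qed.

End RegularOpenAlgebra.

(** * Zero-dimensional locally compact spaces *)

(** Directedness makes the sets [C] minus [S] a filter base. If no [S] covered [C], the filter would
    be proper and cluster at a point of [C], yet some [S] is a neighbourhood of that point. *)
Lemma compact_directed_cover (X : topologicalType) (C : set X)
    (D : set (set X)) :
  compact C -> D !=set0 ->
  (forall S T, D S -> D T -> exists2 R, D R & S `|` T `<=` R) ->
  (forall x, C x -> exists2 S, D S & nbhs x S) ->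
  exists2 S, D S & C `<=` S.
Proof.
move=> cptC D0 dirD covD; apply: contrapT => nD.
pose F := filter_from D (fun S => C `\` S).
have FF : Filter F.
  apply: filter_from_filter => // S T DS DT.
  have [R DR STR] := dirD _ _ DS DT; exists R => // x [Cx nRx].
  by split; split=> // ?; apply/nRx/STR; [left|right].
have PF : ProperFilter F.
  apply: filter_from_proper => S DS; apply/set0P/eqP => CS0.
  by apply: nD; exists S => //; rewrite -setD_eq0.
have [|x [Cx clx]] := cptC F PF.
  by have [S DS] := D0; exists S => // x [].
have [S DS Sx] := covD _ Cx.
have [|y [[_ nSy]]] := clx (C `\` S) S _ Sx; first by exists S.
exact.
Qed.

Definition compact_clopen (X : topologicalType) (K : set X) :=
  compact K /\ clopen K.

Lemma compact_clopen0 (X : topologicalType) : compact_clopen (@set0 X).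
Proof. by split; [exact: compact0|exact: clopen0]. Qed.

Lemma compact_clopenU (X : topologicalType) (K L : set X) :
  compact_clopen K -> compact_clopen L -> compact_clopen (K `|` L).
Proof. by move=> [? ?] [? ?]; split; [exact: compactU|exact: clopenU]. Qed.

Section ZeroDimensionalLocallyCompact.
Variable X : topologicalType.
Hypothesis zlcX : is_zlc X.

(** A basic clopen set chosen inside a compact neighbourhood is closed in it, hence compact. *)
Lemma zlc_base (x : X) N : nbhs x N ->
  exists K, [/\ compact_clopen K, K x & K `<=` N].
Proof.
case: zlcX => _ lcX [B [_ Bbase] Bclopen] Nx.
have := lcX x I; rewrite withinET => -[U Ux [cptU _]].
have [K [BK Kx] KNU] := Bbase x _ (filterI Nx Ux).
exists K; split=> //; last by move=> y /KNU[].
split; last exact: Bclopen.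
apply: (subclosed_compact _ cptU); first by case: (Bclopen _ BK).
by move=> y /KNU[].
Qed.

(** The compact clopen subsets of [V] are closed under unions, so they form a directed cover of [C].
    This yields both (BC1) and the defining property of the objects of [DZLC]. *)
Lemma zlc_interpolation (C V : set X) : compact C -> open V -> C `<=` V ->
  exists K, [/\ compact_clopen K, C `<=` K & K `<=` V].
Proof.
move=> cptC oV CV.
have [||||K [? ?] ?] :=
  @compact_directed_cover X C [set K | compact_clopen K /\ K `<=` V].
- exact: cptC.
- by exists set0; split; [exact: compact_clopen0|].
- move=> K L [kK KV] [kL LV]; exists (K `|` L) => //; split.
    exact: compact_clopenU.
  by rewrite subUset.
- move=> x /CV Vx; have [|K [kK Kx KV]] := @zlc_base x V.
    exact: open_nbhs_nbhs.
  exists K => //; apply: open_nbhs_nbhs; split=> //.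
  by case: kK => _ [].
- by exists K.
Qed.

(** * The local contact algebra of a space *)

Definition regopens_contact (U V : regopens X) :=
  closure U `&` closure V !=set0.

Definition regopens_bounded : set (regopens X) :=
  [set U | compact (closure U)].

(** The closure of the Boolean complement of [V] is the set complement of [reg V], and [reg V] is
    [V] by regularity. *)
Lemma regopens_well_insideP (U V : regopens X) :
  well_inside regopens_contact U V <-> closure U `<=` V.
Proof.
rewrite /well_inside /regopens_contact regset_compl closure_setC.
have -> : (closure V)° = regset V by exact: regopen_regset.
split=> [UV x Ux|UV [x [/UV]]//].
by apply: contrapT => nVx; apply: UV; exists x.
Qed.

Definition clopen_regopens (K : set X) (kK : compact_clopen K) : regopens X :=
  Regopens (clopen_regopen (proj2 kK)).

Lemma clopen_regopens_bounded K (kK : compact_clopen K) :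
  regopens_bounded (clopen_regopens kK).
Proof.
by have [? [_ /closure_id cK]] := kK; rewrite /regopens_bounded /= -cK.
Qed.

Lemma regopens_lca : is_lca regopens_contact regopens_bounded.
Proof.
split.
- split; split.
  + move=> U U0; have [x Ux] : regset U !=set0.
      by apply/set0P; apply: contra U0 => /eqP U0; apply/eqP/regset_inj.
    by exists x; split; exact: subset_closure.
  + move=> U V [x [Ux Vx]]; split; apply/eqP => E.
      by move: Ux; rewrite E regset0 closure0.
    by move: Vx; rewrite E regset0 closure0.
  + by move=> U V [x [? ?]]; exists x.
  + move=> U V W; rewrite /regopens_contact regset_join.
    have -> : closure (reg (regset V `|` regset W)) =
        closure V `|` closure W.
      rewrite -closureU; apply: closure_open_regclosed.
      by apply: openU; exact: open_regset.
    rewrite setIUr; split=> [[x []]|[] [x ?]].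
    * by left; exists x.
    * by right; exists x.
    * by exists x; left.
    * by exists x; right.
  + by rewrite /regopens_bounded /= closure0; exact: compact0.
  + move=> U V cV /regopens_leP UV.
    apply: (subclosed_compact _ cV); first exact: closed_closure.
    exact: closureS.
  + move=> U V cU cV; rewrite /regopens_bounded /=.
    apply: (subclosed_compact _ (compactU cU cV)).
      exact: closed_closure.
    rewrite -closureU /reg closure_open_regclosed//.
    by apply: openU; exact: open_regset.
- move=> U V cU /regopens_well_insideP UV.
  have [K [kK UK KV]] := zlc_interpolation cU (open_regset V) UV.
  have cK : closure K = K by rewrite -(proj1 (closure_id _) (proj2 (proj2 kK))).
  exists (clopen_regopens kK); split; first exact: clopen_regopens_bounded.
  + exact/regopens_well_insideP.
  + by apply/regopens_well_insideP; rewrite /= cK.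
(* (BC2): as [K] is an open set around the contact point, cutting [V] down to [K] keeps that point
   in the closure. *)
- move=> U V [x [Ux Vx]]; have [K [kK Kx _]] := @zlc_base x setT filterT.
  exists (clopen_regopens kK); first exact: clopen_regopens_bounded.
  exists x; split=> //; rewrite regset_meet.
  by apply: setI_closure_subset => //; exact: open_regset.
- move=> U U0; have [x Ux] : regset U !=set0.
    by apply/set0P; apply: contra U0 => /eqP U0; apply/eqP/regset_inj.
  have [|K [kK Kx KU]] := @zlc_base x U.
    by apply: open_nbhs_nbhs; split=> //; exact: open_regset.
  have cK : closure K = K by rewrite -(proj1 (closure_id _) (proj2 (proj2 kK))).
  exists (clopen_regopens kK); split; first exact: clopen_regopens_bounded.
    by apply/eqP => /(congr1 (@regset X)) /= E; move: Kx; rewrite E.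
  by apply/regopens_well_insideP; rewrite /= cK.
Qed.

Definition regopens_clca : clca :=
  CLCA regopens_lca (@regopens_complete X).

End ZeroDimensionalLocallyCompact.

(** * Bounded clopen elements *)

Local Open Scope order_scope.

Definition bounded_clopen (A : clca) (c : A) : Prop :=
  bounded A c /\ c <<[A] c.

Section BoundedClopen.
Variable A : clca.
Implicit Types a b c e : A.

Lemma well_insideC a b : a <<[A] b -> ~` b <<[A] ~` a.
Proof. by rewrite /well_inside complK => ab /contactC. Qed.

Lemma clopen_meet c e : c <<[A] c -> e <<[A] e -> c `&` e <<[A] c `&` e.
Proof.
move=> cc ee; apply: well_insideI.
  by apply: well_insideW cc => //; exact: leIl.
by apply: well_insideW ee => //; exact: leIr.
Qed.

Lemma bounded_clopen0 : bounded_clopen (\bot : A).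
Proof.
split; first exact: bounded0.
by rewrite -compl1; apply: well_insideC; exact: well_inside1.
Qed.

Lemma bounded_clopenI c e :
  bounded_clopen c -> e <<[A] e -> bounded_clopen (c `&` e).
Proof.
move=> [Bc cc] ee; split; first exact: bounded_le Bc (leIl _ _).
exact: clopen_meet.
Qed.

Lemma bounded_clopenD c e :
  bounded_clopen c -> bounded_clopen e -> bounded_clopen (c `&` ~` e).
Proof.
by move=> cP [_ ee]; apply: bounded_clopenI => //; exact: well_insideC.
Qed.

Lemma bounded_clopenU c e :
  bounded_clopen c -> bounded_clopen e -> bounded_clopen (c `|` e).
Proof.
move=> [Bc cc] [Be ee]; split; first exact: boundedU.
rewrite -[_ `|` _]complK complU; apply: well_insideC.
by apply: clopen_meet; exact: well_insideC.
Qed.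

Hypothesis dzlcA : is_dzlc A.

(** [is_dzlc] speaks of pairs of bounded elements; (BC1) first inserts a bounded [e] between [a] and
    [b], so [b] may be arbitrary. *)
Lemma dzlc_interpolation a b : bounded A a -> a <<[A] b ->
  exists2 c, bounded_clopen c & a <= c <= b.
Proof.
move=> Ba ab.
have [_ /(_ _ _ Ba ab) [e [Be ae /well_inside_le eb]] _ _] := clcaP A.
have [c [Bc cc /andP[ac ce]]] := dzlcA Ba Be ae.
by exists c => //; rewrite ac (le_trans ce eb).
Qed.

Lemma bounded_le_clopen a : bounded A a -> exists2 c, bounded_clopen c & a <= c.
Proof.
move=> Ba; have [c Pc /andP[ac _]] := dzlc_interpolation Ba (@well_inside1 A a).
by exists c.
Qed.

(** Join-density of the bounded clopen elements, phrased as an order test: every bounded [e] well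
    inside [a] is below one of them that is itself below [a]. *)
Lemma bounded_clopen_dense a b :
  (forall c, bounded_clopen c -> c <= a -> c <= b) -> a <= b.
Proof.
move=> ab; apply: bounded_dense => e [Be ea].
have [c Pc /andP[ec ca]] := dzlc_interpolation Be ea.
exact: le_trans ec (ab _ Pc ca).
Qed.

Lemma bounded_clopen_neq0 a : a != \bot ->
  exists c, [/\ bounded_clopen c, c != \bot & c <= a].
Proof.
move=> a0; apply: contrapT => na; move/negP: a0; apply.
rewrite -lex0; apply: bounded_clopen_dense => c Pc ca; rewrite lex0.
by apply/negPn/negP => c0; apply: na; exists c.
Qed.

End BoundedClopen.

(** * Morphisms out of a zero-dimensional algebra *)

Section DlcMorphism.
Variables A B : clca.
Hypothesis dzlcA : is_dzlc A.
Implicit Types phi psi : A -> B.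

(** One inequality is disjointness, from (DLC1) and (DLC2); the other is (DLC3) applied to [c] well
    inside itself. *)
Lemma dlc_compl_clopen phi (c : A) : is_dlc_morphism phi -> bounded_clopen c ->
  phi (~` c) = ~` phi c.
Proof.
move=> [phi0 phiI phi_wi _ _] [Bc cc]; apply: le_anti; apply/andP; split.
  by rewrite -disj_leC -phiI meetC meetxC phi0.
by rewrite leCx; apply: well_inside_le; exact: phi_wi.
Qed.

Lemma dlc_clopen phi (c : A) : is_dlc_morphism phi -> bounded_clopen c ->
  phi c <<[B] phi c.
Proof.
move=> phiP Pc; have [_ _ phi_wi _ _] := phiP; have [Bc cc] := Pc.
by have := phi_wi _ _ Bc cc; rewrite (dlc_compl_clopen phiP Pc) complK.
Qed.

Lemma dlc_le phi (a b : A) : is_dlc_morphism phi -> a <= b -> phi a <= phi b.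
Proof. by move=> [_ phiI _ _ _]; exact: premorph_le. Qed.

Lemma dlc_morphism_clopen_le phi psi :
  is_dlc_morphism phi -> is_dlc_morphism psi ->
  (forall c, bounded_clopen c -> phi c = psi c) -> forall a, phi a <= psi a.
Proof.
move=> phiP psiP e a; have [_ _ _ _ ->] := phiP.
apply: bigjoin_lub => _ [b [Bb ba] <-].
have [c Pc /andP[bc ca]] := dzlc_interpolation dzlcA Bb ba.
apply: le_trans (dlc_le phiP bc) _; rewrite (e _ Pc); exact: dlc_le.
Qed.

Lemma dlc_hom_clopen_inj (f g : dlc_hom A B) :
  (forall c, bounded_clopen c -> sval f c = sval g c) -> f = g.
Proof.
move=> e; apply: dlc_hom_inj => a; apply: le_anti.
apply/andP; split; apply: dlc_morphism_clopen_le; try exact: svalP.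
  exact: e.
by move=> c /e.
Qed.

(** A criterion that tests (DLC3) and (DLC5) on bounded clopen elements only. Interpolation extends
    the former to all pairs; for the latter, a bounded clopen [c] below [a] already belongs to
    [inner a]. *)
Lemma dzlc_morphism phi :
  phi \bot = \bot ->
  (forall a b, phi (a `&` b) = phi a `&` phi b) ->
  (forall c, bounded_clopen c -> phi (~` c) = ~` phi c) ->
  (forall c, bounded_clopen c -> phi c <<[B] phi c) ->
  (forall b, bounded B b -> exists2 a, bounded A a & b <= phi a) ->
  (forall a e,
    (forall c, bounded_clopen c -> c <= a -> phi c <= e) -> phi a <= e) ->
  is_dlc_morphism phi.
Proof.
move=> phi0 phiI phiC phi_cl phi_cof phi_join; split=> //.
- move=> a b Ba ab; have [c Pc /andP[ac cb]] := dzlc_interpolation dzlcA Ba ab.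
  apply: well_insideW (phi_cl _ Pc); last exact: premorph_le.
  by rewrite leCx -phiC//; apply: premorph_le => //; rewrite leC.
- move=> a; apply: le_anti; apply/andP; split; last exact: hat_le.
  apply: phi_join => c [Bc cc] ca; apply: le_hat; split=> //.
  exact: well_insideW (lexx _) ca cc.
Qed.

End DlcMorphism.

(** A bounded clopen [c] belongs to [inner c], so the join defining the composite is attained at
    [c]. *)
Lemma diamond_clopen (A B C : clca) (psi : B -> C) (phi : A -> B) (c : A) :
  is_dlc_morphism psi -> is_dlc_morphism phi -> bounded_clopen c ->
  diamond psi phi c = psi (phi c).
Proof.
move=> psiP phiP Pc; apply: le_anti; apply/andP; split; last first.
  by apply: bigjoin_ub; exists c.
apply: bigjoin_lub => _ [b [_ /well_inside_le bc] <-].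
exact/(dlc_le psiP)/(dlc_le phiP).
Qed.

Section OrderIsomorphism.
Variables (A B : clca) (phi : A -> B) (psi : B -> A).
Hypotheses (phiK : cancel phi psi) (psiK : cancel psi phi).
Hypothesis phi_le : {mono phi : a b / a <= b}.
Hypothesis phi_clopen : forall c, bounded_clopen c -> bounded_clopen (phi c).
Hypothesis psi_clopen : forall c, bounded_clopen c -> bounded_clopen (psi c).
Hypotheses (dzlcA : is_dzlc A) (dzlcB : is_dzlc B).

(** An order isomorphism respects the Boolean structure, and in a zero-dimensional algebra the ideal
    and the relation [<<] on it are determined by the bounded clopen elements, which [phi] and [psi]
    match. *)
Lemma order_iso_dlc : is_dlc_morphism phi.
Proof.
have phi0 : phi \bot = \bot.
  by apply: le_anti; rewrite le0x -(psiK \bot) phi_le le0x.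
have phi1 : phi \top = \top.
  by apply: le_anti; rewrite lex1 -(psiK \top) phi_le lex1.
have phiI a b : phi (a `&` b) = phi a `&` phi b.
  apply: le_anti; rewrite lexI !phi_le leIl leIr /=.
  by rewrite -(psiK (_ `&` _)) phi_le lexI -!phi_le psiK leIl leIr.
have phiU a b : phi (a `|` b) = phi a `|` phi b.
  apply: le_anti; rewrite leUx !phi_le leUl leUr /= andbT.
  by rewrite -(psiK (_ `|` _)) phi_le leUx -!phi_le psiK leUl leUr.
apply: dzlc_morphism => //.
- move=> c _; apply: le_anti; rewrite -disj_leC -phiI meetC meetxC phi0 eqxx /=.
  by rewrite -[X in _ <= X]complK -disj_leC -complU -phiU joinxC phi1 compl1.
- by move=> c /phi_clopen[].
- move=> b Bb; have [c Pc bc] := bounded_le_clopen dzlcB Bb.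
  exists (psi c); first by have [] := psi_clopen Pc.
  by rewrite psiK.
- move=> a e ae; rewrite -(psiK e) phi_le; apply: (bounded_clopen_dense dzlcA).
  by move=> c Pc ca; rewrite -phi_le psiK; exact: ae.
Qed.

End OrderIsomorphism.

(** * The dual of a continuous map *)

Section RegopensClca.
Variables (X : topologicalType) (zlcX : is_zlc X).
Local Notation RO := (regopens_clca zlcX).

Lemma regopens_clca_leP (U V : RO) :
  (U <= V) <-> ((regset U `<=` regset V)%classic : Prop).
Proof. by split=> [/regopens_leP|?]; last exact/regopens_leP. Qed.

Lemma bounded_clopenP (U : RO) : bounded_clopen U <-> compact_clopen (regset U).
Proof.
split=> [[bU /regopens_well_insideP UU]|[cU [oU /closure_id cl]]].
  have cl : closure (regset U) = regset U.
    by apply/seteqP; split=> //; exact: subset_closure.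
  rewrite /compact_clopen -{1}cl; split=> //; split; first exact: open_regset.
  by rewrite -cl; exact: closed_closure.
split; first by rewrite /= /regopens_bounded /= -cl.
by apply/regopens_well_insideP; rewrite -cl.
Qed.

Lemma regopens_dzlc : is_dzlc RO.
Proof.
move=> U V bU _ /regopens_well_insideP UV.
have [K [kK UK KV]] := zlc_interpolation zlcX bU (open_regset V) UV.
have [bK cK] : @bounded_clopen RO (clopen_regopens kK) by exact/bounded_clopenP.
exists (clopen_regopens kK); split=> //; apply/andP; split.
  by apply/regopens_clca_leP => x /subset_closure /UK.
exact/regopens_clca_leP.
Qed.

Lemma regset_clopen_compl (U : RO) : bounded_clopen U ->
  regset (~` U) = (~` regset U)%classic.
Proof.
by move=> /bounded_clopenP[_ [_ /closure_id]]; rewrite regset_compl => <-.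
Qed.

End RegopensClca.

(** * Regularized preimage: morphism property, faithfulness, fullness, perfect maps *)

Section Preimage.
Variables X Y : topologicalType.
Hypotheses (zlcX : is_zlc X) (zlcY : is_zlc Y).
Local Notation ROX := (regopens_clca zlcX).
Local Notation ROY := (regopens_clca zlcY).

Definition regpreimage (f : X -> Y) (U : ROY) : ROX :=
  regopens_of (f @^-1` regset U)%classic.

Lemma regpreimage_clopen f (U : ROY) : continuous f -> bounded_clopen U ->
  regset (regpreimage f U) = (f @^-1` regset U)%classic.
Proof.
move=> f_cts /bounded_clopenP[_ clU].
by rewrite /= /reg; exact/clopen_regopen/preimage_clopen.
Qed.

Lemma regpreimage_dlc f : continuous f -> is_dlc_morphism (regpreimage f).
Proof.
move=> f_cts.
have op (U : ROY) : open (f @^-1` regset U)%classic.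
  by apply: open_comp => [x _|]; [exact: f_cts|exact: open_regset].
have preclopen (U : ROY) : bounded_clopen U ->
    clopen (f @^-1` regset U)%classic.
  by move=> /bounded_clopenP[_ clU]; exact: preimage_clopen.
apply: dzlc_morphism.
- exact: regopens_dzlc.
- by apply: regset_inj; rewrite /= preimage_set0 /reg closure0 interior0.
- move=> U V; apply: regset_inj.
  by rewrite /= preimage_setI regI//; exact: op.
- move=> U PU; apply: regset_inj.
  rewrite regset_compl (regpreimage_clopen f_cts PU).
  rewrite -[LHS]/(reg (f @^-1` (regset (~` U)%O))%classic) (regset_clopen_compl PU).
  rewrite preimage_setC.
  have [_ /closure_id <-] := preclopen U PU.
  exact: clopen_regopen (clopenC set0 (preclopen U PU)).
- move=> U PU; apply/regopens_well_insideP; rewrite regpreimage_clopen//.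
  by have [_ /closure_id <-] := preclopen U PU.
- move=> V bV.
  (* (DLC4): the image of a compact closure is compact, so a compact clopen set encloses it. *)
  have cfV : compact (f @` closure (regset V))%classic.
    by apply: continuous_compact => //; exact: continuous_subspaceT.
  have [K [kK fVK _]] := zlc_interpolation zlcY cfV openT (@subsetT _ _).
  have PK : @bounded_clopen ROY (clopen_regopens kK) by exact/bounded_clopenP.
  exists (clopen_regopens kK); first by case: PK.
  apply/regopens_clca_leP; rewrite regpreimage_clopen// => x /subset_closure Vx.
  by apply: fVK; exists x.
- move=> U V UV; apply/regopens_of_le; first exact: op.
  (* The preimage of [U] is the union of the preimages of the compact clopen sets inside [U], each
     contained in [V] by hypothesis. *)
  move=> x Ux; have [|K [kK Kx KU]] := @zlc_base _ zlcY (f x) (regset U).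
    by apply: open_nbhs_nbhs; split=> //; exact: open_regset.
  have PK : @bounded_clopen ROY (clopen_regopens kK) by exact/bounded_clopenP.
  have KU' : (clopen_regopens kK : ROY) <= U by exact/regopens_clca_leP.
  have /regopens_clca_leP := UV _ PK KU'.
  by rewrite regpreimage_clopen//; exact.
Qed.

Lemma regpreimage_inj f g : continuous f -> continuous g ->
  regpreimage f = regpreimage g -> f = g.
Proof.
move=> f_cts g_cts fg; apply/funext => x; apply: contrapT => nfg.
have [hY _ _] := zlcY.
have [N Nf Ng] : exists2 N, nbhs (f x) N & ~ (N (g x)).
  have := @accessible_closed_set1 _ (hausdorff_accessible hY) (g x).
  move=> cl; exists (~` [set g x])%classic; last exact.
  by apply: open_nbhs_nbhs; split; [exact: closed_openC|].
have [K [kK Kf KN]] := zlc_base zlcY Nf.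
have PK : @bounded_clopen ROY (clopen_regopens kK) by exact/bounded_clopenP.
apply/Ng/KN; have := regpreimage_clopen g_cts PK.
rewrite -fg regpreimage_clopen//= => /seteqP[+ _]; exact.
Qed.

(** Agreement on bounded clopen elements is enough, because [dlc_hom_clopen_inj] extends it to all
    elements. *)
Lemma regpreimage_full (phi : ROY -> ROX) : is_dlc_morphism phi ->
  exists2 f, continuous f & forall U, bounded_clopen U -> phi U = regpreimage f U.
Proof.
move=> phiP; have [phi0 phiI _ phi_cof _] := phiP.
have phiC (U : ROY) : bounded_clopen U ->
    regset (phi (~` U)) = (~` regset (phi U))%classic.
  move=> PU; rewrite (dlc_compl_clopen phiP PU) regset_compl.
  have /regopens_well_insideP clU := dlc_clopen phiP PU.
  by congr (~` _)%classic; apply/seteqP; split=> //; exact: subset_closure.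
have point x : exists y, forall U : ROY, bounded_clopen U ->
    (regset (phi U) x <-> regset U y).
  (* (DLC4), applied to a compact clopen neighbourhood of [x], gives a bounded clopen [W] with [x]
     in [phi W]; the filter base below is therefore nonempty. *)
  have [L [kL Lx _]] := @zlc_base _ zlcX x setT filterT.
  have [bL _] : @bounded_clopen ROX (clopen_regopens kL) by exact/bounded_clopenP.
  have [W0 bW0 LW0] := phi_cof _ bL.
  have [W PW W0W] := bounded_le_clopen (@regopens_dzlc _ zlcY) bW0.
  have Wx : regset (phi W) x.
    have /regopens_clca_leP := le_trans LW0 (dlc_le phiP W0W); exact.
  pose D := [set U : ROY | bounded_clopen U /\ regset (phi U) x]%classic.
  pose F := filter_from D (@regset Y).
  have FF : Filter F.
    apply: filter_from_filter; first by exists W.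
    move=> U V [PU Ux] [PV Vx]; exists (U `&` V) => //; split.
      by apply: bounded_clopenI => //; case: PV.
    by rewrite phiI.
  have PF : ProperFilter F.
    apply: filter_from_proper => U [PU Ux]; apply/set0P/eqP => U0.
    have E : U = \bot by apply: regset_inj; rewrite U0.
    by move: Ux; rewrite E phi0.
  have /bounded_clopenP[cW _] := PW.
  (* A cluster point of the filter exists by compactness of [W]; it lies in every member of the base
     since these are closed. *)
  have [|y [Wy cly]] := cW F PF; first by exists W.
  have in_phi (U : ROY) : bounded_clopen U -> regset (phi U) x -> regset U y.
    move=> PU Ux; have /bounded_clopenP[_ [_ clU]] := PU.
    by apply: clU => N Ny; apply: cly => //; exists U.
  exists y => U PU; split; first exact: in_phi.
  (* Were [x] outside [phi U], it would lie in the image of [W] minus [U], which forces [y] out of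
     [U]. *)
  move=> Uy; apply: contrapT => nUx.
  have : regset (W `&` ~` U) y.
    apply: in_phi; first exact: bounded_clopenD.
    by rewrite phiI; split=> //; rewrite phiC.
  by rewrite regset_meet (regset_clopen_compl PU) => -[].
have [f fP] := choice point.
have fpre (U : ROY) : bounded_clopen U ->
    regset (phi U) = (f @^-1` regset U)%classic.
  by move=> PU; apply/seteqP; split=> x /(fP x U PU).
have f_cts : continuous f.
  move=> x N Nfx; have [K [kK Kf KN]] := zlc_base zlcY Nfx.
  have PK : @bounded_clopen ROY (clopen_regopens kK) by exact/bounded_clopenP.
  rewrite nbhs_simpl /=; apply: (@filterS _ _ _ (f @^-1` K)%classic).
    by move=> z; exact: KN.
  have <- := fpre _ PK; apply: open_nbhs_nbhs; split; first exact: open_regset.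
  by rewrite fpre.
exists f => // U PU; apply: regset_inj; rewrite regpreimage_clopen//; exact: fpre.
Qed.

(** Forward, the closure of the regularized preimage lies in the preimage of [closure U], compact
    because [f] is perfect. Backward, the hypothesis on compact clopen sets makes their preimages
    compact, and every point of [Y] has such a neighbourhood. *)
Lemma regpreimage_perfect f : continuous f ->
  perfect f <-> forall U, bounded ROY U -> bounded ROX (regpreimage f U).
Proof.
move=> f_cts; have [hX _ _] := zlcX; have [hY _ _] := zlcY; split.
  move=> f_perf U bU.
  have cfU := perfect_compact_preimage f_perf bU.
  apply: (subclosed_compact _ cfU); first exact: closed_closure.
  have cl : closed (f @^-1` closure (regset U))%classic.
    by apply: preimage_closed => //; exact: closed_closure.
  rewrite [X in (_ `<=` X)%classic](proj1 (closure_id _) cl) /= /reg.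
  rewrite closure_open_regclosed; first by apply: closureS => x /= /subset_closure.
  by apply: open_comp => [x _|]; [exact: f_cts|exact: open_regset].
move=> f_bdd.
have cpre K : compact_clopen K -> compact (f @^-1` K)%classic.
  move=> kK.
  have PK : @bounded_clopen ROY (clopen_regopens kK) by exact/bounded_clopenP.
  have := f_bdd _ (proj1 PK); rewrite /= /regopens_bounded /=.
  have clK : clopen (f @^-1` K)%classic
    by exact: preimage_clopen (proj2 kK) f_cts.
  by rewrite /reg (clopen_regopen clK); case: clK => _ /closure_id <-.
split=> // [C clC|y].
  rewrite closure_id; apply/seteqP; split; first exact: subset_closure.
  (* Closedness is local: inside [K] the image of [C] is the image of a compact set, hence closed,
     and [y] is in its closure. *)
  move=> y yC; have [K [kK Ky _]] := @zlc_base _ zlcY y setT filterT.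
  have : closed (f @` (f @^-1` K `&` C))%classic.
    apply: compact_closed => //; apply: continuous_compact.
      exact: continuous_subspaceT.
    by apply: compact_closedI => //; exact: cpre.
  move=> /(_ y)[|x [_ Cx] <-]; last by exists x.
  move=> N Ny; have [|_ [[x Cx <-] [Nfx Kfx]]] := yC (N `&` K)%classic.
    by apply: filterI => //; apply: open_nbhs_nbhs; split=> //; case: kK => _ [].
  by exists (f x); split=> //; exists x.
have [K [kK Ky _]] := @zlc_base _ zlcY y setT filterT.
apply: (subclosed_compact _ (cpre K kK)); last by move=> x /= ->.
apply: preimage_closed => //; apply: accessible_closed_set1.
exact: hausdorff_accessible.
Qed.

End Preimage.

(** * The Stone space of bounded clopen elements *)

(** Proper prime filters of the generalized Boolean algebra of bounded clopen elements. That algebra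
    may lack a top, so nonemptiness is a clause of its own. *)
Record is_stone_point (A : clca) (p : set A) : Prop := IsStonePoint {
  stone_clopen : forall c, p c -> bounded_clopen c;
  stone_inhabited : exists c, p c;
  stone_neq0 : ~ p \bot;
  stone_meet : forall c e, p c -> p e -> p (c `&` e);
  stone_le : forall c e, p c -> bounded_clopen e -> c <= e -> p e;
  stone_prime : forall c e, bounded_clopen c -> bounded_clopen e ->
    p (c `|` e) -> p c \/ p e
}.

Definition stone (A : clca) := {p : set A | is_stone_point p}.

HB.instance Definition _ A := gen_eqMixin (stone A).
HB.instance Definition _ A := gen_choiceMixin (stone A).

Section StoneTopology.
Variable A : clca.
Implicit Types (p q : stone A) (a c e : A).

Definition stone_basic c : set (stone A) := [set p | sval p c]%classic.

Definition stone_open (W : set (stone A)) : Prop :=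
  forall p, W p -> exists2 c, sval p c & (stone_basic c `<=` W)%classic.

Fact stone_openT : stone_open setT.
Proof. by move=> p _; have [c pc] := stone_inhabited (svalP p); exists c. Qed.

Fact stone_openI : setI_closed stone_open.
Proof.
move=> V W oV oW p [/oV[c pc cV] /oW[e pe eW]].
exists (c `&` e); first exact: (stone_meet (svalP p)).
move=> q qce; split.
  apply/cV/(stone_le (svalP q) qce); last exact: leIl.
  exact: stone_clopen (svalP p) _ pc.
apply/eW/(stone_le (svalP q) qce); last exact: leIr.
exact: stone_clopen (svalP p) _ pe.
Qed.

Fact stone_open_bigU (I : Type) (W : I -> set (stone A)) :
  (forall i, stone_open (W i)) -> stone_open (\bigcup_i W i)%classic.
Proof.
move=> oW p [i _ /oW[c pc cW]]; exists c => // q qc.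
by exists i => //; exact: cW.
Qed.

HB.instance Definition _ := isOpenTopological.Build (stone A)
  stone_openT stone_openI stone_open_bigU.

Lemma stone_openE (W : set (stone A)) : open W = stone_open W.
Proof. by []. Qed.

Lemma nbhs_stoneP p N :
  nbhs p N <-> exists2 c, sval p c & (stone_basic c `<=` N)%classic.
Proof.
rewrite nbhsE; split=> [[W [oW Wp] WN]|[c pc cN]].
  have [c pc cW] := oW _ Wp; exists c => //; exact: subset_trans WN.
exists (stone_basic c) => //; split=> //.
by rewrite stone_openE => q qc; exists c.
Qed.

Lemma stone_basic_meet c e : bounded_clopen c -> bounded_clopen e ->
  stone_basic (c `&` e) = (stone_basic c `&` stone_basic e)%classic.
Proof.
move=> Pc Pe; apply/seteqP; split=> p; last first.
  by move=> [pc pe]; exact: (stone_meet (svalP p)).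
by move=> pce; split; apply: (stone_le (svalP p) pce) => //; rewrite (leIl, leIr).
Qed.

(** The ultrafilter dichotomy relative to [c]: the complement of [e] may be unbounded, so primeness
    is applied to the splitting of [c] by [e]. *)
Lemma stone_basic_compl p c e : bounded_clopen c -> bounded_clopen e ->
  sval p c -> sval p e \/ sval p (c `&` ~` e).
Proof.
move=> Pc Pe pc.
have [||||] // := @stone_prime _ _ (svalP p) (c `&` e) (c `&` ~` e).
- by apply: bounded_clopenI => //; case: Pe.
- exact: bounded_clopenD.
- by rewrite -meetUr joinxC meetx1.
- move=> pce; left; apply: (stone_le (svalP p) pce) => //; exact: leIr.
by right.
Qed.

Lemma stone_disjoint p c e : sval p c -> sval p e -> c `&` e != \bot.
Proof.
move=> pc pe; apply/eqP => E.
by apply: (stone_neq0 (svalP p)); rewrite -E; exact: (stone_meet (svalP p)).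
Qed.

Lemma clopen_stone_basic c : bounded_clopen c -> clopen (stone_basic c).
Proof.
move=> Pc; split; first by rewrite stone_openE => p pc; exists c.
rewrite -openC stone_openE => p npc; have [e pe] := stone_inhabited (svalP p).
have Pe := stone_clopen (svalP p) pe.
exists (e `&` ~` c).
  by have [] := stone_basic_compl Pe Pc pe.
move=> q qec qc; have := stone_disjoint qec qc.
by rewrite -meetA [_ `&` c]meetC meetxC meetx0 eqxx.
Qed.

(* An ultrafilter of subsets of the space converges to the point made of all
   bounded clopen [e] whose basic open set it contains. *)
Lemma compact_stone_basic c : bounded_clopen c -> compact (stone_basic c).
Proof.
move=> Pc; rewrite compact_ultra => F FU Fc.
pose p : set A := [set e | bounded_clopen e /\ F (stone_basic e)]%classic.
have pP : is_stone_point p.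
  split.
  - by move=> e [].
  - by exists c.
  - move=> [_ /filter_ex[q]]; exact: stone_neq0 (svalP q).
  - move=> e e' [Pe Fe] [Pe' Fe']; split; last first.
      by rewrite stone_basic_meet//; exact: filterI.
    by apply: bounded_clopenI => //; case: Pe'.
  - move=> e e' [Pe Fe] Pe' ee'; split=> //; apply: filterS Fe => q qe.
    exact: stone_le (svalP q) _ _ qe Pe' ee'.
  - move=> e e' Pe Pe' [_ Fee'].
    have [Fe|nFe] := in_ultra_setVsetC (stone_basic e) FU; first by left.
    right; split=> //; apply: filterS (filterI Fee' nFe) => q [qee' nqe].
    by have [] := stone_prime (svalP q) Pe Pe' qee'.
exists (exist _ p pP); split; first by split.
by move=> N /nbhs_stoneP[e [_ Fe] eN]; exact: filterS Fe.
Qed.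

Lemma stone_zlc : is_zlc (stone A).
Proof.
split.
- move=> p q pq; apply: eq_sig_hprop => [x u v|]; first exact: Prop_irrelevance.
  apply/seteqP.
  (* Basic sets are closed, so a point that cannot be separated from [p'] contains every element of
     [p']; symmetry then gives equality. *)
  have sub (p' q' : stone A) :
      cluster (nbhs p') q' -> (sval p' `<=` sval q')%classic.
    move=> cl c pc; have Pc := stone_clopen (svalP p') pc.
    apply: (proj2 (clopen_stone_basic Pc)) => N Nq; apply: cl => //.
    by apply/nbhs_stoneP; exists c.
  split; first exact: sub.
  by apply: sub => N M Np Mq; rewrite setIC; exact: pq.
- move=> p _; rewrite withinET.
  have [c pc] := stone_inhabited (svalP p); have Pc := stone_clopen (svalP p) pc.
  exists (stone_basic c); first by apply/nbhs_stoneP; exists c.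
  by split; [exact: compact_stone_basic|case: (clopen_stone_basic Pc)].
- exists (stone_basic @` [set c | bounded_clopen c])%classic.
    split; first by move=> _ [c Pc <-]; case: (clopen_stone_basic Pc).
    move=> p N /nbhs_stoneP[c pc cN]; exists (stone_basic c) => //; split=> //.
    by exists c => //; exact: stone_clopen (svalP p) _ pc.
  by move=> _ [c Pc <-]; exact: clopen_stone_basic.
Qed.

(* An ultrafilter on [A] containing the nonzero elements below [c] and all sets
   that are dense and open for the order topology decides every [e]. *)
Lemma stone_basic_neq0 c : bounded_clopen c -> c != \bot ->
  (stone_basic c !=set0)%classic.
Proof.
move=> Pc c0.
pose dense (E : set A) := (forall x y, E x -> y <= x -> E y) /\
  (forall x, x != \bot -> exists y, [/\ E y, y != \bot & y <= x]).
pose below (e : A) := [set x : A | x <= e]%classic.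
pose F := filter_from dense
  (fun E => E `&` below c `&` [set x | x != \bot])%classic.
have FF : Filter F.
  apply: filter_from_filter.
    by exists setT; split=> // x x0; exists x.
  move=> E E' [lE dE] [lE' dE']; exists (E `&` E')%classic.
    split=> [x y [Ex E'x] yx|x x0].
      by split; [exact: lE yx|exact: lE' yx].
    have [y [Ey y0 yx]] := dE _ x0; have [z [E'z z0 zy]] := dE' _ y0.
    by exists z; split=> //; [split=> //; exact: lE zy|exact: le_trans yx].
  by move=> x [[[Ex E'x] xc] x0].
have PF : ProperFilter F.
  apply: filter_from_proper => E [lE dE]; have [y [Ey y0 yc]] := dE _ c0.
  by exists y.
have [G [GU FG]] := ultraFilterLemma PF.
have Gdense E : dense E -> G (E `&` below c `&` [set x | x != \bot])%classic.
  by move=> dE; apply: FG; exists E.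
have denseT : dense setT by split=> // x x0; exists x.
have Gc : G (below c) by apply: filterS (Gdense _ denseT) => x [[]].
pose p : set A := [set e | bounded_clopen e /\ G (below e)]%classic.
have pP : is_stone_point p.
  split.
  - by move=> e [].
  - by exists c.
  - move=> [_ G0]; have [x [x0 [_]]] := filter_ex (filterI G0 (Gdense _ denseT)).
    by rewrite /= -lex0 x0.
  - move=> e e' [Pe Ge] [Pe' Ge']; split.
      by apply: bounded_clopenI => //; case: Pe'.
    by apply: filterS (filterI Ge Ge') => x [xe xe']; rewrite /below /= lexI xe.
  - move=> e e' [Pe Ge] Pe' ee'; split=> //; apply: filterS Ge => x xe.
    exact: le_trans ee'.
  - move=> e e' Pe Pe' [_ Gee'].
    have de : dense (below e `|` below (~` e)%O)%classic.
      split=> [x y [xe|xe] yx|x x0].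
      + by left; exact: le_trans xe.
      + by right; exact: le_trans xe.
      + have [xe|xe] := eqVneq (x `&` e) \bot.
          by exists x; split=> //; right; rewrite /below /= -disj_leC xe.
        by exists (x `&` e); split=> //; [left; exact: leIr|exact: leIl].
    have [Ge|nGe] := in_ultra_setVsetC (below e) GU; first by left.
    right; split=> //.
    apply: filterS (filterI (filterI Gee' nGe) (Gdense _ de)) => x.
    move=> [[xee' nxe] [[[//|xe] _] _]].
    have xe0 : x `&` e = \bot by apply/eqP; rewrite disj_leC.
    by rewrite /below /= -[x](meet_idPl xee') meetUr xe0 join0x leIr.
by exists (exist _ p pP).
Qed.

End StoneTopology.

(** * A zero-dimensional algebra is the regular open algebra of its Stone space *)

Section StoneDuality.
Variable A : clca.
Hypothesis dzlcA : is_dzlc A.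
Local Notation RO := (regopens_clca (@stone_zlc A)).
Implicit Types (p q : stone A) (a b c e : A).

(** Extends [stone_basic] to all of [A]: a Stone point contains only bounded clopen elements, so a
    general [a] is reached through those below it. *)
Definition stone_below a : set (stone A) :=
  [set p | exists2 c, sval p c & c <= a]%classic.

Lemma stone_below_open a : open (stone_below a).
Proof.
by rewrite stone_openE => p [c pc ca]; exists c => // q qc; exists c.
Qed.

Lemma stone_below_clopen c : bounded_clopen c -> stone_below c = stone_basic c.
Proof.
move=> Pc; apply/seteqP; split=> p; last by move=> pc; exists c.
by move=> [e pe ec]; exact: (stone_le (svalP p)) pe Pc ec.
Qed.

(** If [c] were not below [a], a nonzero bounded clopen [e] would fit under [c] minus [a]; a point
    of its basic set would lie in that of [c] and have a neighbourhood missing [stone_below a].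
    Regularity of [stone_below a] and order reflection both rest on this. *)
Lemma stone_basic_closure c a : bounded_clopen c ->
  (stone_basic c `<=` closure (stone_below a))%classic -> c <= a.
Proof.
move=> Pc ca; rewrite -[a]complK -disj_leC; apply/negPn/negP => ca0.
have [e [Pe e0 eca]] := bounded_clopen_neq0 dzlcA ca0.
have [p pe] := stone_basic_neq0 Pe e0.
have pc : sval p c.
  by apply: (stone_le (svalP p)) pe Pc (le_trans eca (leIl _ _)).
have [|q [[e' qe' e'a] qe]] := ca _ pc (stone_basic e).
  by apply/nbhs_stoneP; exists e.
have := stone_disjoint qe' qe; rewrite -lex0.
rewrite (le_trans (leI2 e'a eca))// meetCA meetxC meetx0.
exact: lexx.
Qed.

Lemma stone_below_regopen a : regopen (stone_below a).
Proof.
apply/seteqP; split; last exact/subset_reg/stone_below_open.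
move=> p /nbhs_stoneP[c pc ca]; exists c => //.
exact: stone_basic_closure (stone_clopen (svalP p) pc) ca.
Qed.

Definition stone_map a : RO := Regopens (stone_below_regopen a).

Definition stone_inv (U : RO) : A :=
  bigjoin [set c | bounded_clopen c /\ stone_basic c `<=` regset U]%classic.

Lemma stone_map_le : {mono stone_map : a b / a <= b}.
Proof.
move=> a b; apply/idP/idP => [/regopens_clca_leP ab|ab]; last first.
  apply/regopens_clca_leP => p [c pc ca]; exists c => //; exact: le_trans ab.
apply: (bounded_clopen_dense dzlcA) => c Pc ca.
apply: stone_basic_closure => // p pc; apply/subset_closure/ab.
by exists c.
Qed.

(** The join in [stone_inv] could only add points in the closure of [U]: a basic set of [e] missing
    [U] makes [e] disjoint from each joinand, hence from the join, so [e] cannot meet a [c] below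
    the join. Regularity of [U] then absorbs the added points. *)
Lemma stone_invK : cancel stone_inv stone_map.
Proof.
move=> U; apply: regset_inj; apply/seteqP; split=> p; last first.
  move=> Up; have := open_regset U; rewrite stone_openE => /(_ _ Up)[c pc cU].
  exists c => //.
  by apply: bigjoin_ub; split=> //; exact: stone_clopen (svalP p) _ pc.
move=> [c pc cU]; rewrite -(regopen_regset U); apply/nbhs_stoneP; exists c => //.
move=> q qc N /nbhs_stoneP[e qe eN].
have Pc := stone_clopen (svalP q) qc; have Pe := stone_clopen (svalP q) qe.
apply: contrapT => UN; have /negP := stone_disjoint qc qe; apply.
rewrite -lex0; apply: le_trans (leI2 cU (lexx _)) _; rewrite meetC.
apply: meet_bigjoin_le => d [Pd dU]; rewrite lex0; apply/negPn/negP => ed.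
have Ped : bounded_clopen (e `&` d) by apply: bounded_clopenI => //; case: Pd.
have [r] := stone_basic_neq0 Ped ed; rewrite stone_basic_meet// => -[re rd].
by apply: UN; exists r; split; [exact: dU|exact: eN].
Qed.

Lemma stone_mapK : cancel stone_map stone_inv.
Proof.
move=> a; apply: le_anti; rewrite -!stone_map_le stone_invK.
by rewrite lexx.
Qed.

Lemma stone_map_bounded_clopen c :
  bounded_clopen c -> bounded_clopen (stone_map c).
Proof.
move=> Pc; apply/bounded_clopenP; rewrite /= stone_below_clopen//.
by split; [exact: compact_stone_basic|exact: clopen_stone_basic].
Qed.

(** Basic sets inside [U] are closed under finite unions, so compactness makes [U] itself basic,
    hence the image of a bounded clopen element. *)
Lemma stone_inv_bounded_clopen (U : RO) :
  bounded_clopen U -> bounded_clopen (stone_inv U).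
Proof.
move=> /bounded_clopenP[cU [+ _]]; rewrite stone_openE => oU.
have [|||_ [[c Pc <-] cU'] Uc] := @compact_directed_cover _ _
  [set W | (@stone_basic A @` [set c | bounded_clopen c]) W /\
    W `<=` regset U]%classic cU.
- exists (stone_basic \bot); split; first by exists \bot => //; exact: bounded_clopen0.
  by move=> p /(stone_neq0 (svalP p)).
- move=> _ _ [[c Pc <-] cU'] [[e Pe <-] eU].
  have Pce := bounded_clopenU Pc Pe.
  have E : stone_basic (c `|` e) = (stone_basic c `|` stone_basic e)%classic.
    apply/seteqP; split=> p.
      by move=> /(stone_prime (svalP p) Pc Pe)[]; [left|right].
    move=> [pc|pe].
      exact: (stone_le (svalP p)) pc Pce (leUl _ _).
    exact: (stone_le (svalP p)) pe Pce (leUr _ _).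
  exists (stone_basic (c `|` e)); last by rewrite E.
  by split; [exists (c `|` e)|rewrite E subUset].
- move=> p /oU[c pc cU']; exists (stone_basic c); last first.
    by apply/nbhs_stoneP; exists c.
  by split=> //; exists c => //; exact: stone_clopen (svalP p) _ pc.
suff -> : U = stone_map c by rewrite stone_mapK.
by apply: regset_inj; rewrite /= stone_below_clopen//; exact/seteqP.
Qed.

Lemma stone_map_dlc : is_dlc_morphism stone_map.
Proof.
apply: (order_iso_dlc stone_invK stone_map_le stone_map_bounded_clopen
  stone_inv_bounded_clopen dzlcA).
exact: regopens_dzlc.
Qed.

Lemma stone_inv_dlc : is_dlc_morphism stone_inv.
Proof.
apply: (order_iso_dlc stone_mapK _ stone_inv_bounded_clopen
  stone_map_bounded_clopen _ dzlcA); last exact: regopens_dzlc.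
by move=> U V; rewrite -stone_map_le !stone_invK.
Qed.

End StoneDuality.

(** * Equivalences of categories *)

Section FullyFaithful.
Variables (C D : category) (F : functor C D).
Hypothesis F_faithful :
  forall (x y : C) (f g : hom x y), fmap F f = fmap F g -> f = g.
Hypothesis F_full :
  forall (x y : C) (h : hom (F x) (F y)), exists f : hom x y, fmap F f = h.
Hypothesis F_surj :
  forall d : D, exists (c : C) (i : hom (F c) d), is_isomorphism i.

(** Choice selects an object over each [d] with an isomorphism; the inverse functor lifts conjugates
    by these isomorphisms. Faithfulness reduces each of its laws to an equation in [D]. *)
Lemma fully_faithful_equivalent : equivalent C D.
Proof.
pose obj d := projT1 (cid (F_surj d)).
pose iso d : hom (F (obj d)) d := projT1 (cid (projT2 (cid (F_surj d)))).
have isoP d : is_isomorphism (iso d) := projT2 (cid (projT2 (cid (F_surj d)))).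
pose inv d : hom d (F (obj d)) := projT1 (cid (isoP d)).
have invK d : comp (inv d) (iso d) = idm _.
  by rewrite /inv; case: cid => ? [].
have isoK d : comp (iso d) (inv d) = idm _.
  by rewrite /inv; case: cid => ? [].
pose lift x y (h : hom (F x) (F y)) := projT1 (cid (F_full h)).
have liftK x y (h : hom (F x) (F y)) : fmap F (lift x y h) = h.
  by rewrite /lift; case: cid.
have lift_id d : lift _ _ (comp (inv d) (comp (idm d) (iso d))) = idm (obj d).
  by apply: F_faithful; rewrite liftK fmap_id comp_idl invK.
have lift_comp d e k (g : hom e k) (f : hom d e) :
    lift _ _ (comp (inv k) (comp (comp g f) (iso d))) =
    comp (lift _ _ (comp (inv k) (comp g (iso e))))
         (lift _ _ (comp (inv e) (comp f (iso d)))).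
  apply: F_faithful; rewrite fmap_comp !liftK -!compA; congr (comp _ (comp _ _)).
  by rewrite !compA isoK comp_idl.
pose G := @Functor D C obj
  (fun d e h => lift _ _ (comp (inv e) (comp h (iso d)))) lift_id lift_comp.
exists F, G; split.
  exists (fun x => lift _ _ (inv (F x))); split=> [x y f|x].
    apply: F_faithful; rewrite /= !fmap_comp !liftK -!compA isoK.
    by rewrite comp_idr.
  exists (lift _ _ (iso (F x))).
  by split; apply: F_faithful; rewrite fmap_comp !liftK fmap_id ?isoK ?invK.
exists iso; split=> // d e h.
by rewrite /= liftK compA isoK comp_idl.
Qed.

End FullyFaithful.

(** * The two dualities *)

Definition zlc_dual (X : ZLC) : DZLC :=
  exist is_dzlc (regopens_clca (svalP X)) (@regopens_dzlc _ (svalP X)).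

Definition zlc_dual_map (X Y : ZLC) (f : hom X Y) :
    hom (zlc_dual Y) (zlc_dual X) :=
  exist _ (@regpreimage _ _ (svalP X) (svalP Y) f)
    (regpreimage_dlc (svalP X) (svalP Y) (@cts_fun _ _ f)).

Lemma zlc_dual_map_id (X : ZLC) : zlc_dual_map (idm X) = idm (zlc_dual X).
Proof.
apply: dlc_hom_inj => U; apply: regset_inj.
by rewrite /= /reg regopen_regset.
Qed.

(** It suffices to compare on bounded clopen elements, where [diamond] is plain composition and
    [regpreimage] is plain preimage. *)
Lemma zlc_dual_map_comp (X Y Z : ZLC) (g : hom Y Z) (f : hom X Y) :
  zlc_dual_map (comp g f) = comp (zlc_dual_map f) (zlc_dual_map g).
Proof.
apply: dlc_hom_clopen_inj => [|U PU]; first exact: regopens_dzlc.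
have f_cts := @cts_fun _ _ f; have g_cts := @cts_fun _ _ g.
have gf_cts := @cts_fun _ _ (g \o f : continuousType _ _).
rewrite [RHS](diamond_clopen (regpreimage_dlc _ _ f_cts)
  (regpreimage_dlc _ _ g_cts)) //.
apply: regset_inj; rewrite [LHS](regpreimage_clopen _ gf_cts)//.
rewrite -[RHS]/(reg (f @^-1` regset (regpreimage (svalP Y) g U))%classic).
rewrite (regpreimage_clopen _ g_cts PU).
exact/esym/(regpreimage_clopen (svalP X) gf_cts PU).
Qed.

Definition zlc_duality : functor ZLC (opposite DZLC) :=
  @Functor ZLC (opposite DZLC) zlc_dual zlc_dual_map zlc_dual_map_id
    (fun X Y Z g f => zlc_dual_map_comp g f).

Lemma zlc_dual_map_inj (X Y : ZLC) (f g : hom X Y) :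
  zlc_dual_map f = zlc_dual_map g -> f = g.
Proof.
move=> /(congr1 sval) fg; apply/continuousEP => x.
by rewrite (regpreimage_inj (@cts_fun _ _ f) (@cts_fun _ _ g) fg).
Qed.

Lemma zlc_dual_map_full (X Y : ZLC) (phi : hom (zlc_dual Y) (zlc_dual X)) :
  exists f : hom X Y, zlc_dual_map f = phi.
Proof.
have [f f_cts fphi] := regpreimage_full (svalP phi).
exists (mkcts f_cts : continuousType _ _).
apply: dlc_hom_clopen_inj => [|U PU]; first exact: regopens_dzlc.
by rewrite fphi.
Qed.

Definition stone_space (A : DZLC) : ZLC := exist is_zlc _ (stone_zlc (sval A)).

Definition stone_hom (A : DZLC) : hom A (zlc_dual (stone_space A)) :=
  exist _ _ (stone_map_dlc (svalP A)).

Definition stone_hom_inv (A : DZLC) : hom (zlc_dual (stone_space A)) A :=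
  exist _ _ (stone_inv_dlc (svalP A)).

Lemma stone_homK (A : DZLC) : comp (stone_hom_inv A) (stone_hom A) = idm A.
Proof.
apply: dlc_hom_clopen_inj => [|c Pc]; first exact: svalP A.
rewrite [LHS](diamond_clopen (svalP (stone_hom_inv A))
  (svalP (stone_hom A)) Pc).
exact: (stone_mapK (svalP A)).
Qed.

Lemma stone_hom_invK (A : DZLC) :
  comp (stone_hom A) (stone_hom_inv A) = idm (zlc_dual (stone_space A)).
Proof.
apply: dlc_hom_clopen_inj => [|c Pc]; first exact: regopens_dzlc.
rewrite [LHS](diamond_clopen (svalP (stone_hom A))
  (svalP (stone_hom_inv A)) Pc).
exact: (stone_invK (svalP A)).
Qed.

Lemma zlc_dually_equivalent : dually_equivalent ZLC DZLC.
Proof.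
apply: (@fully_faithful_equivalent _ _ zlc_duality).
- exact: zlc_dual_map_inj.
- exact: zlc_dual_map_full.
(* Arrows are reversed in the opposite category, so [stone_hom A] leads from the dual of the Stone
   space to [A], and the two cancellation laws trade places. *)
- move=> A; exists (stone_space A), (stone_hom A).
  by exists (stone_hom_inv A); split; [exact: stone_hom_invK|exact: stone_homK].
Qed.

(** * Restriction to perfect maps and boundedness-preserving morphisms *)

Definition pzlc_dual (X : PZLC) : DPZLC := zlc_dual X.

Lemma zlc_dual_map_bounded (X Y : PZLC) (f : hom X Y) :
  preserves_bounded (zlc_dual_map (sval f)).
Proof.
have [f_perf _] :=
  regpreimage_perfect (svalP X) (svalP Y) (@cts_fun _ _ (sval f)).
exact: f_perf (svalP f).
Qed.

Definition pzlc_dual_map (X Y : PZLC) (f : hom X Y) :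
    hom (pzlc_dual Y) (pzlc_dual X) :=
  exist _ (zlc_dual_map (sval f)) (@zlc_dual_map_bounded _ _ f).

Lemma pal_hom_inj (A B : PAL) (f g : hom A B) : sval f = sval g -> f = g.
Proof. exact: whom_inj. Qed.

Lemma pzlc_dual_map_id (X : PZLC) : pzlc_dual_map (idm X) = idm (pzlc_dual X).
Proof. by apply: pal_hom_inj; exact: zlc_dual_map_id. Qed.

Lemma pzlc_dual_map_comp (X Y Z : PZLC) (g : hom Y Z) (f : hom X Y) :
  pzlc_dual_map (comp g f) = comp (pzlc_dual_map f) (pzlc_dual_map g).
Proof. by apply: pal_hom_inj; exact: zlc_dual_map_comp. Qed.

Definition pzlc_duality : functor PZLC (opposite DPZLC) :=
  @Functor PZLC (opposite DPZLC) pzlc_dual pzlc_dual_map pzlc_dual_map_id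
    (fun X Y Z g f => pzlc_dual_map_comp g f).

Lemma pzlc_dual_map_full (X Y : PZLC) (phi : hom (pzlc_dual Y) (pzlc_dual X)) :
  exists f : hom X Y, pzlc_dual_map f = phi.
Proof.
have [f fphi] := @zlc_dual_map_full X Y (sval phi).
have f_perf : perfect f.
  apply/(regpreimage_perfect (svalP X) (svalP Y) (@cts_fun _ _ f)) => U bU.
  by have := svalP phi U bU; rewrite -fphi.
by exists (exist _ f f_perf); apply: pal_hom_inj.
Qed.

(** Puts the Stone isomorphism in [PAL]: a bounded element lies under a bounded clopen one, whose
    image is bounded. *)
Lemma stone_map_bounded (A : clca) (dzlcA : is_dzlc A) (a : A) :
  bounded A a -> bounded (regopens_clca (stone_zlc A)) (stone_map dzlcA a).
Proof.
move=> /(bounded_le_clopen dzlcA)[c Pc ac].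
have [bc _] := stone_map_bounded_clopen dzlcA Pc.
by apply: bounded_le bc _; rewrite stone_map_le.
Qed.

Lemma stone_inv_bounded (A : clca) (dzlcA : is_dzlc A)
    (U : regopens_clca (stone_zlc A)) :
  bounded (regopens_clca (stone_zlc A)) U -> bounded A (stone_inv U).
Proof.
move=> /(bounded_le_clopen (@regopens_dzlc _ (stone_zlc A)))[V PV UV].
have [bV _] := stone_inv_bounded_clopen dzlcA PV.
by apply: bounded_le bV _; rewrite -(stone_map_le dzlcA) !stone_invK.
Qed.

Lemma pzlc_dually_equivalent : dually_equivalent PZLC DPZLC.
Proof.
apply: (@fully_faithful_equivalent _ _ pzlc_duality).
- move=> X Y f g /(congr1 sval) fg; apply: whom_inj; exact: zlc_dual_map_inj fg.
- exact: pzlc_dual_map_full.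
- move=> A; exists (stone_space A).
  exists (exist _ (stone_hom A) (@stone_map_bounded _ (svalP A))).
  exists (exist _ (stone_hom_inv A) (@stone_inv_bounded _ (svalP A))).
  split; apply: pal_hom_inj; [exact: stone_hom_invK|exact: stone_homK].
Qed.

Theorem theorem1p2 :
  dually_equivalent ZLC DZLC /\ dually_equivalent PZLC DPZLC.
Proof. by split; [exact: zlc_dually_equivalent|exact: pzlc_dually_equivalent]. Qed.
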